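(* Let $n\ge 2$ and let $h$ be the dilation of $\mathbb{R}^n$ with signature of positive integers $r_1\le r_2\le\dots\le r_n$. If $r_n-2r_{n-1}\ne0$, then every derivation of weight $0$ of the nilpotent Lie algebra $\mathfrak{g}_{<0}(h)$ is given by the adjoint action $Y\mapsto[X,Y]$ of a vector field $X\in\mathfrak{g}_0(h)$. If $r_n=2r_{n-1}$, then the derivations of weight $0$ of $\mathfrak{g}_{<0}(h)$ consist of $\mathfrak{g}_0(h)$ extended by derivations of the second kind, i.e. they are exactly the maps of the form $Y\mapsto[X,Y]+D(Y)$ with $X\in\mathfrak{g}_0(h)$ and $D$ a derivation of the second kind.
   Context: The dilation $h$ of $\mathbb{R}^n$ (coordinates $x^1,\dots,x^n$) with signature of positive integers $r_1\le\dots\le r_n$ is $h_t(x^1,\dots,x^n)=(t^{r_1}x^1,\dots,t^{r_n}x^n)$, with weight vector field $\nabla^h=\sum_i r_i x^i\partial_{x^i}$. For $k\in\mathbb{Z}$, $\mathfrak{g}_k(h)$ is the real vector space of smooth vector fields $X$ on $\mathbb{R}^n$ with $[\nabla^h,X]=kX$ (vector fields of weight $k$); these are automatically polynomial, $\mathfrak{g}_k(h)=0$ for $k<-r_n$, and $[\mathfrak{g}_k(h),\mathfrak{g}_l(h)]\subset\mathfrak{g}_{k+l}(h)$. $\mathfrak{g}_{<0}(h)=\bigoplus_{p=-r_n}^{-1}\mathfrak{g}_p(h)$ is a finite-dimensional nilpotent graded Lie algebra. A derivation of weight $0$ of $\mathfrak{g}_{<0}(h)$ is a linear map $D:\mathfrak{g}_{<0}(h)\to\mathfrak{g}_{<0}(h)$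 with $D(\mathfrak{g}_p(h))\subset\mathfrak{g}_p(h)$ for all $p<0$ and $D([X,Y])=[D(X),Y]+[X,D(Y)]$ for all $X,Y\in\mathfrak{g}_{<0}(h)$. Derivations of the second kind (case $r_n=2r_{n-1}$). A derivation $D$ of weight $0$ of $\mathfrak{g}_{<0}(h)$ is of the second kind if $D(\partial_{x^i})=0$ for all $i$ and, for some symmetric real matrix $A=(a_i^j)_{i,j=1}^{n-1}$ with $a_i^j\ne0$ only if $r_i=r_j=r_{n-1}$, one has $D(x^i\partial_{x^j})=\delta_j^n\sum_{k=1}^{n-1}a_i^k\,\partial_{x^k}$ for all linear vector fields $x^i\partial_{x^j}\in\mathfrak{g}_{<0}(h)$ (i.e. $r_i<r_j$). *)

(* Defs.v *)
From HB Require Import structures.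
From mathcomp Require Import all_boot all_order all_algebra.
From mathcomp Require Import all_classical all_reals all_analysis.
Set Implicit Arguments.
Unset Strict Implicit.
Unset Printing Implicit Defensive.
Import Order.TTheory GRing.Theory Num.Theory.
Import numFieldNormedType.Exports.
Local Open Scope ring_scope.

(* A vector field \sum_j X^j d/dx^j on R^n is the map x |-> (X^1 x, ..., X^n x).
   This is a notation, so that the pointwise linear structure on functions is
   the one on vector fields. *)
Notation vfield R n := ('rV[R]_n -> 'rV[R]_n).

Section VectorFields.
Context {R : realType} {n : nat}.
Implicit Types X Y : vfield R n.

Fixpoint ntimes_diff (k : nat) X : Prop :=
  if k is k'.+1 then
    (forall x, differentiable X x) /\
    (forall i : 'I_n, ntimes_diff k' ('D_(delta_mx 0 i) X))
  else True.

Definition smooth X : Prop := forall k, ntimes_diff k X.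

(* [X, Y]^j = \sum_i (X^i dY^j/dx^i - Y^i dX^j/dx^i) *)
Definition lie X Y : vfield R n := fun x => 'D_(X x) Y x - 'D_(Y x) X x.

Definition partial (i : 'I_n) : vfield R n := fun=> delta_mx 0 i.

Definition xpartial (i j : 'I_n) : vfield R n := fun x => x 0 i *: delta_mx 0 j.

Definition weight_vfield (r : 'I_n -> nat) : vfield R n :=
  fun x => \row_i ((r i)%:R * x 0 i).

Definition gr (r : 'I_n -> nat) (k : int) X : Prop :=
  smooth X /\ lie (weight_vfield r) X = k%:~R *: X.

End VectorFields.

Section NegativePart.
Context {R : realType} {n : nat}.
Variable r : 'I_n.+1 -> nat.
Implicit Types X Y : vfield R n.+1.

(* The sum of the gr r (- p), 1 <= p <= r_n. It is direct, its summands being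
   eigenspaces of lie (weight_vfield r) for distinct eigenvalues. *)
Definition gneg X : Prop :=
  exists Z : 'I_(r ord_max) -> vfield R n.+1,
    (forall p : 'I_(r ord_max), gr r (- (p.+1)%:Z) (Z p)) /\ X = \sum_(p < r ord_max) Z p.

(* A linear map on the subspace gneg is represented by a total map on vector
   fields of which only the values on gneg are constrained; two such maps are
   compared on gneg only. *)
Definition derivation0 (D : vfield R n.+1 -> vfield R n.+1) : Prop :=
  [/\ forall X, gneg X -> gneg (D X),
      forall (a : R) X Y, gneg X -> gneg Y -> D (a *: X + Y) = a *: D X + D Y,
      forall (p : int) X, p < 0 -> gr r p X -> gr r p (D X)
    & forall X Y, gneg X -> gneg Y -> D (lie X Y) = lie (D X) Y + lie X (D Y)].

End NegativePart.

Section SecondKind.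
Context {R : realType} {m : nat}.
Variable r : 'I_m.+2 -> nat.

(* With n = m + 2, the indices 1, ..., n-1 are 'I_m.+1, embedded in 'I_m.+2
   with the same value. *)
Definition emb (i : 'I_m.+1) : 'I_m.+2 := widen_ord (leqnSn m.+1) i.

(* the index n - 1 *)
Definition penult : 'I_m.+2 := emb ord_max.

(* For nondecreasing r, a linear field x^i d/dx^j with r_i < r_j has i < j, so
   letting i range over 1, ..., n-1 loses nothing. *)
Definition second_kind (D : vfield R m.+2 -> vfield R m.+2) : Prop :=
  [/\ derivation0 r D,
      forall i, D (partial i) = 0
    & exists A : 'M[R]_m.+1,
      [/\ A^T = A,
          forall i j, A i j != 0 ->
            r (emb i) = r penult /\ r (emb j) = r penult
        & forall (i : 'I_m.+1) (j : 'I_m.+2), (r (emb i) < r j)%N ->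
            D (xpartial (emb i) j) =
            (j == ord_max)%:R *: \sum_(k < m.+1) A i k *: partial (emb k)]].

End SecondKind.

(* Main.v *)
(* Along the flow x |-> (e^(r_i s) x^i)_i of the weight field, a smooth function
   that is an eigenvector of weight w is multiplied by e^(w s).  Letting s tend
   to - infinity, it vanishes if w < 0 and is constant if w = 0; if w > 0, Euler's
   identity expresses it by its partial derivatives, of smaller weight.  Hence
   the fields in the g_k are polynomial.

   Let D be a derivation of weight 0 of g_{<0}.  As the d_i commute, the fields
   D d_i are, up to sign, the partial derivatives of some X in g_0, so that
   D - ad X kills every d_i.  Assume that D does.  Then D (x^i d_j) is a constant
   field c_ij, nonzero in direction k only if r_i + r_k = r_j.  Applying D to
   [x^i d_j, x^k d_l] shows that c_ij^k is symmetric in i and k, vanishes unless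
   r_i = r_k, and vanishes if some l <> j has r_l > r_i.  So a nonzero c_ij^k forces
   j = n and r_i = r_k = r_(n-1), whence r_n = 2 r_(n-1).  Finally, if D also
   kills the x^i d_j, then by induction on the weight D (f d_j) is constant, and
   applying D to [f d_j, x^k d_j] = 0 for r_k < r_j shows that it is zero. *)
Require Import Defs.
From HB Require Import structures.
From mathcomp Require Import all_boot all_order all_algebra.
From mathcomp Require Import all_classical all_reals all_analysis.
From mathcomp Require Import ring lra zify.
Import Order.TTheory GRing.Theory Num.Theory.
Import numFieldNormedType.Exports.
Set Implicit Arguments.
Unset Strict Implicit.
Unset Printing Implicit Defensive.
Local Open Scope classical_set_scope.
Local Open Scope ring_scope.

(** * Directional derivatives and the bracket, component by component *)

Section Directional.
Context {R : realType} {n : nat}.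
Implicit Types (f g : 'rV[R]_n -> R) (X Y : vfield R n).

Definition comp X (j : 'I_n) : 'rV[R]_n -> R := fun x => X x 0 j.

(* act and bracket are locked, because comparing two distinct directional
   derivatives by unfolding does not terminate in practice. *)
Fact derive_key : unit. Proof. exact: tt. Qed.
Definition act : vfield R n -> ('rV[R]_n -> R) -> 'rV[R]_n -> R :=
  locked_with derive_key (fun X f x => 'D_(X x) f x).
Definition bracket : vfield R n -> vfield R n -> vfield R n :=
  locked_with derive_key lie.

Lemma bracketE X Y : bracket X Y = lie X Y.
Proof. by rewrite /bracket unlock. Qed.

Lemma actE X f x : act X f x = 'D_(X x) f x.
Proof. by rewrite /act unlock. Qed.

Lemma derive_linear_dir (W : normedModType R) (f : 'rV[R]_n -> W) x a u v :
  differentiable f x -> 'D_(a *: u + v) f x = a *: 'D_u f x + 'D_v f x.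
Proof. by move=> df; rewrite !deriveE// linearP. Qed.

Lemma derive_sum_dir f x v : differentiable f x ->
  'D_v f x = \sum_i v 0 i * 'D_(delta_mx 0 i) f x.
Proof.
move=> df; rewrite deriveE// [in LHS](row_sum_delta v) linear_sum.
by apply: eq_bigr => i _; rewrite linearZ deriveE.
Qed.

Lemma differentiable_comp_field X j x :
  differentiable X x -> differentiable (comp X j) x.
Proof.
move=> dX; apply: (@differentiable_comp _ _ _ _ X (fun y : 'rV[R]_n => y 0 j : R)) => //.
exact: differentiable_coord.
Qed.

Lemma comp_derive X j v x : differentiable X x ->
  ('D_v X x) 0 j = 'D_v (comp X j) x.
Proof. by move=> dX; rewrite derive_mx ?mxE//; exact: diff_derivable. Qed.

Lemma comp_bracket X Y j : (forall x, differentiable X x) ->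
  (forall x, differentiable Y x) ->
  comp (bracket X Y) j = act X (comp Y j) - act Y (comp X j).
Proof.
move=> dX dY; apply/funext => x.
rewrite -[RHS]/(act X (comp Y j) x - act Y (comp X j) x) !actE -!comp_derive//.
by rewrite bracketE /comp /lie !mxE.
Qed.

Lemma field_ext X Y : (forall j, comp X j = comp Y j) -> X = Y.
Proof.
move=> XY; apply/funext => x; apply/rowP => j.
exact: (congr1 (@^~ x) (XY j)).
Qed.

End Directional.

(** * The dilation flow and homogeneous functions *)

Section Flow.
Context {R : realType} {n : nat}.
Variable r : 'I_n -> nat.
Implicit Types (f : 'rV[R]_n -> R) (w s : R).

(** The dilation h_t at t = e^s; in the parameter s it is the one-parameter group generated by
    [weight_vfield r]. *)
Definition flow s (x : 'rV[R]_n) : 'rV[R]_n := \row_i (expR ((r i)%:R * s) * x 0 i).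

Definition flow_homogeneous w f := forall s x, f (flow s x) = expR (w * s) * f x.

Lemma is_derive_flow s x :
  is_derive s (1 : R) (flow^~ x) (weight_vfield r (flow s x)).
Proof.
have d1 (i : 'I_n) : is_derive s (1 : R) (fun t => expR ((r i)%:R * t) * x 0 i)
    ((r i)%:R * (expR ((r i)%:R * s) * x 0 i)).
  have dl : is_derive s (1 : R) (fun t => (r i)%:R * t) ((r i)%:R).
    by apply: trigger_derive; rewrite /GRing.scale/= ?mulr0 ?addr0 ?mulr1.
  have := @is_derive1_comp _ expR (fun t => (r i)%:R * t) s _ _ (is_derive_expR _) dl.
  move=> d2; have -> : (fun t : R => expR ((r i)%:R * t) * x 0 i)
      = x 0 i \*: (expR \o (fun t => (r i)%:R * t)).
    by apply/funext => t /=; rewrite mulrC.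
  by apply: is_derive_eq; rewrite /GRing.scale/=; ring.
have dv : derivable (flow^~ x) s 1.
  apply/derivable_mxP => i j; rewrite ord1.
  have -> : (fun t => flow t x 0 j) = (fun t => expR ((r j)%:R * t) * x 0 j).
    by apply/funext => t; rewrite mxE.
  by have [] := d1 j.
apply: DeriveDef => //; rewrite derive_mx//; apply/rowP => j; rewrite !mxE.
have -> : (fun t => flow t x 0 j) = (fun t => expR ((r j)%:R * t) * x 0 j).
  by apply/funext => t; rewrite mxE.
by have [] := d1 j.
Qed.

Lemma flow0 x : flow 0 x = x.
Proof. by apply/rowP => i; rewrite mxE mulr0 expR0 mul1r. Qed.

Lemma is_derive_along_flow f s x : (forall y, differentiable f y) ->
  is_derive s (1 : R) (fun t => f (flow t x)) (act (weight_vfield r) f (flow s x)).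
Proof.
move=> df; have [dv ev] := is_derive_flow s x.
have dd : differentiable (flow^~ x) s by exact/derivable1_diffP.
have dc : differentiable (f \o (flow^~ x)) s by exact: differentiable_comp.
apply: DeriveDef; first exact/derivable1_diffP.
rewrite -[LHS]/('D_1 (f \o (flow^~ x)) s) deriveE// diff_comp//=.
by rewrite actE deriveE// -ev [in RHS]deriveE.
Qed.

(** Euler's identity integrated along the flow: it makes the derivative in s of e^(- w s) f (flow s
    x) vanish. Conversely, differentiate the homogeneity relation at s = 0. *)
Lemma flow_homogeneousP w f : (forall y, differentiable f y) ->
  (forall x, act (weight_vfield r) f x = w * f x) <-> flow_homogeneous w f.
Proof.
move=> df; split=> [eul s x|hom x].
  suff : expR (- w * s) * f (flow s x) = expR (- w * 0) * f (flow 0 x).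
    rewrite flow0 mulr0 expR0 mul1r => <-.
    by rewrite mulrA -expRD mulNr subrr expR0 mul1r.
  apply: (@is_derive_0_is_cst _ (fun t => expR (- w * t) * f (flow t x))) => t.
  have dl : is_derive t (1 : R) (fun t => - w * t) (- w).
    by apply: trigger_derive; rewrite /GRing.scale/= ?mulr0 ?addr0 ?mulr1.
  have de := @is_derive1_comp _ expR (fun t => - w * t) t _ _ (is_derive_expR _) dl.
  have dm := is_deriveM de (is_derive_along_flow t x df).
  by apply: is_derive_eq dm _; rewrite /GRing.scale/= eul; ring.
have d1 := is_derive_along_flow 0 x df.
have dl : is_derive (0 : R) (1 : R) (fun t => w * t) w.
  by apply: trigger_derive; rewrite /GRing.scale/= ?mulr0 ?addr0 ?mulr1.
have de := @is_derive1_comp _ expR (fun t => w * t) 0 _ _ (is_derive_expR _) dl.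
have d2 : is_derive (0 : R) (1 : R) (f x \*: (expR \o (fun t => w * t))) (w * f x).
  by apply: is_derive_eq; rewrite /GRing.scale/= mulr0 expR0; ring.
rewrite -[x in LHS]flow0 -(@derive_val _ _ _ _ _ _ _ d1) -(@derive_val _ _ _ _ _ _ _ d2).
congr ('D_(1 : R) _ _); apply/funext => t; rewrite /= hom mulrC//.
Qed.

Lemma flow_homogeneous_partial w f (i : 'I_n) : (forall y, differentiable f y) ->
  flow_homogeneous w f ->
  flow_homogeneous (w - (r i)%:R) ('D_(delta_mx 0 i) f).
Proof.
move=> df hom s x.
have -> : 'D_(delta_mx 0 i) f (flow s x)
    = expR (- (r i)%:R * s) * 'D_(flow s (delta_mx 0 i)) f (flow s x).
  have -> : flow s (delta_mx 0 i) = expR ((r i)%:R * s) *: delta_mx 0 i + 0.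
    apply/rowP => j; rewrite !mxE eqxx/= addr0.
    by have [->|_] := eqVneq j i => //=; rewrite !mulr0.
  rewrite derive_linear_dir// derive0 addr0 /GRing.scale/= mulrA -expRD.
  by rewrite mulNr addNr expR0 mul1r.
suff -> : 'D_(flow s (delta_mx 0 i)) f (flow s x) = expR (w * s) * 'D_(delta_mx 0 i) f x.
  by rewrite mulrA -expRD; congr (expR _ * _); ring.
have dfx : derivable f x (delta_mx 0 i) by exact: diff_derivable.
have -> : expR (w * s) * 'D_(delta_mx 0 i) f x = 'D_(delta_mx 0 i) (expR (w * s) \*: f) x.
  by rewrite deriveZ.
have -> : expR (w * s) \*: f = f \o flow s by apply/funext => y; rewrite /= hom.
(* As [flow s] is linear, the two difference quotients agree for every increment. *)
rewrite /derive; set F := (X in lim (X @ _)); set G := (X in _ = lim (X @ _)).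
suff -> : F = G by []; apply/funext => h; rewrite /F /G /=.
congr (_ *: (f _ - _)); apply/rowP => j; rewrite !mxE; ring.
Qed.

Hypothesis r_gt0 : forall i, (0 < r i)%N.

(** Every r_i is at least 1, so the norm of [flow (- k%:R) x] is at most e^(- k) times that of x. *)
Lemma cvg_flow0 x : flow (- k%:R) x @[k --> \oo] --> (0 : 'rV[R]_n).
Proof.
apply/norm_cvg0P; apply: (@squeeze_cvgr _ _ _ _ (fun=> 0) (fun k => expR (- k%:R) * `|x|)).
- apply: nearW => k; rewrite normr_ge0/= [leLHS]/Num.Def.normr/= mx_normrE.
  apply: bigmax_le => [|[i j] _]; first by rewrite mulr_ge0 ?expR_ge0.
  rewrite mxE normrM ger0_norm ?expR_ge0//= ler_pM ?expR_ge0//.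
    rewrite ler_expR mulrN lerN2 ler_peMl// ler1n; exact: r_gt0.
  rewrite [leRHS]/Num.Def.normr/= mx_normrE.
  exact: (@le_bigmax _ _ _ _ (fun ij : 'I_1 * 'I_n => `|x ij.1 ij.2|) (0, j)).
- exact: cvg_cst.
- by rewrite -(mul0r `|x|); apply: cvgMl; exact: cvgn_expR.
Qed.

Lemma cvg_along_flow f x : differentiable f 0 ->
  f (flow (- k%:R) x) @[k --> \oo] --> f 0.
Proof.
move=> df; apply: (@cvg_comp _ _ _ (fun k => flow (- k%:R) x) f _ (nbhs (0 : 'rV[R]_n))).
  exact: cvg_flow0.
exact: differentiable_continuous df.
Qed.

Lemma flow_homogeneous0 f x : differentiable f 0 ->
  flow_homogeneous 0 f -> f x = f 0.
Proof.
move=> df hom; apply/esym/(cvg_unique _ (cvg_along_flow x df)) => //.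
rewrite [X in X @ _](_ : _ = cst (f x)); first exact: cvg_cst.
by apply/funext => k /=; rewrite hom mul0r expR0 mul1r.
Qed.

(** By homogeneity f x equals e^(w k) f (flow (- k) x) for every k, a null sequence times a
    convergent one. *)
Lemma flow_homogeneous_lt0 w f x : differentiable f 0 ->
  flow_homogeneous w f -> w < 0 -> f x = 0.
Proof.
move=> df hom w0; have cf := cvg_along_flow x df.
have ce : expR (w * k%:R) @[k --> \oo] --> (0 : R).
  under eq_cvg do rewrite expRM_natr.
  by apply: cvg_expr; rewrite ger0_norm ?expR_ge0// expR_lt1.
have cm : expR (w * k%:R) * f (flow (- k%:R) x) @[k --> \oo] --> (0 : R).
  by rewrite -(mul0r (f 0)); exact: cvgM.
apply: (cvg_unique _ _ cm) => //.
rewrite [X in X @ _](_ : _ = cst (f x)); first exact: cvg_cst.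
by apply/funext => k /=; rewrite hom mulrA -expRD mulrN subrr expR0 mul1r.
Qed.

End Flow.

(** * Polynomial functions and fields *)

Section PolynomialFunctions.
Context {R : realType} {n : nat}.
Implicit Types (f g : 'rV[R]_n -> R) (X Y Z : vfield R n).

(** Generation from constants and coordinates by sums and products lets identities between
    derivations be proved by induction. *)
Inductive polyfun : ('rV[R]_n -> R) -> Prop :=
| polyfun_cst c : polyfun (cst c)
| polyfun_coord i : polyfun (fun x => x 0 i)
| polyfunD f g : polyfun f -> polyfun g -> polyfun (f + g)
| polyfunM f g : polyfun f -> polyfun g -> polyfun (f * g).

Lemma polyfunZ c f : polyfun f -> polyfun (c *: f).
Proof. by move=> pf; apply: (polyfunM (polyfun_cst c)). Qed.

Lemma polyfunN f : polyfun f -> polyfun (- f).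
Proof. by rewrite -scaleN1r; apply: polyfunZ. Qed.

Lemma polyfunB f g : polyfun f -> polyfun g -> polyfun (f - g).
Proof. by move=> pf pg; apply: polyfunD => //; apply: polyfunN. Qed.

Lemma polyfun_sum (I : finType) (F : I -> 'rV[R]_n -> R) :
  (forall i, polyfun (F i)) -> polyfun (\sum_i F i).
Proof. by move=> pF; elim/big_rec: _ => [|i f _]; [exact: (polyfun_cst 0)|apply: polyfunD]. Qed.

Lemma polyfun_diff f x : polyfun f -> differentiable f x.
Proof.
elim=> [c|i|g h _ dg _ dh|g h _ dg _ dh].
- exact: differentiable_cst.
- exact: differentiable_coord.
- exact: differentiableD.
- exact: differentiableM.
Qed.

Lemma act_cst X c : act X (cst c) = 0.
Proof. by apply/funext => x; rewrite actE derive_cst. Qed.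

Lemma act0 X : act X 0 = 0.
Proof. exact: act_cst. Qed.

Lemma act_coord X j : act X (fun x => x 0 j) = comp X j.
Proof.
apply/funext => x; rewrite actE /comp.
have did : derivable (@id 'rV[R]_n) x (X x) by exact: derivable_id.
by have := congr1 (fun M : 'rV[R]_n => M 0 j) (derive_mx did); rewrite derive_id mxE => ->.
Qed.

Lemma actD X f g : polyfun f -> polyfun g -> act X (f + g) = act X f + act X g.
Proof.
move=> pf pg; apply/funext => x; rewrite actE deriveD -?actE//;
  by apply: diff_derivable; apply: polyfun_diff.
Qed.

Lemma actM X f g : polyfun f -> polyfun g -> act X (f * g) = act X f * g + f * act X g.
Proof.
move=> pf pg; apply/funext => x; rewrite actE deriveM -?actE; last 2 first.
- by apply: diff_derivable; apply: polyfun_diff.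
- by apply: diff_derivable; apply: polyfun_diff.
by rewrite addrC; congr (_ + _); rewrite /GRing.scale/= mulrC.
Qed.

Lemma actZ X c f : polyfun f -> act X (c *: f) = c *: act X f.
Proof.
move=> pf; rewrite [LHS](actM X (polyfun_cst c) pf) act_cst mul0r add0r; exact: erefl.
Qed.

Lemma actB X f g : polyfun f -> polyfun g -> act X (f - g) = act X f - act X g.
Proof.
move=> pf pg; rewrite actD//; last exact: polyfunN.
by congr (_ + _); rewrite -(scaleN1r g) actZ// scaleN1r.
Qed.

Lemma act_sum X (I : finType) (F : I -> 'rV[R]_n -> R) :
  (forall i, polyfun (F i)) -> act X (\sum_i F i) = \sum_i act X (F i).
Proof.
move=> pF.
have [] // : polyfun (\sum_i F i) /\ act X (\sum_i F i) = \sum_i act X (F i).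
elim/big_rec2: _ => [|i f g _ [pg <-]]; first by split; [exact: (polyfun_cst 0)|exact: act_cst].
by rewrite actD//; split=> //; apply: polyfunD.
Qed.

Lemma act_linear a X Y f : polyfun f -> act (a *: X + Y) f = a *: act X f + act Y f.
Proof.
move=> pf; apply/funext => x; rewrite actE derive_linear_dir -?actE//; exact: polyfun_diff.
Qed.

Lemma act_scale a X f : polyfun f -> act (a *: X) f = a *: act X f.
Proof.
move=> pf; rewrite -[a *: X]addr0 act_linear//.
by rewrite [act 0 f](_ : _ = 0) ?addr0//; apply/funext => x; rewrite actE derive0.
Qed.

Lemma act_sum_partial X f : polyfun f -> act X f = \sum_i comp X i * act (partial i) f.
Proof.
move=> pf; apply/funext => x; rewrite actE derive_sum_dir; last exact: polyfun_diff.
by rewrite fct_sumE; apply: eq_bigr => i _; rewrite -actE.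
Qed.

Definition polyfield X := forall j, polyfun (comp X j).

Lemma polyfield_diff X x : polyfield X -> differentiable X x.
Proof.
move=> pX; have -> : X = \sum_j (fun x => comp X j x *: (delta_mx 0 j : 'rV[R]_n)).
  by apply/funext => y; rewrite fct_sumE [LHS]row_sum_delta.
apply: differentiable_sum => j.
apply: differentiableZl; exact: polyfun_diff.
Qed.

Lemma polyfun_act X f : polyfield X -> polyfun f -> polyfun (act X f).
Proof.
move=> pX; elim=> [c|i|g h pg pXg ph pXh|g h pg pXg ph pXh].
- by rewrite act_cst; exact: (polyfun_cst 0).
- by rewrite act_coord.
- by rewrite actD//; apply: polyfunD.
- by rewrite actM//; apply: polyfunD; apply: polyfunM.
Qed.

Lemma comp_linear a X Y j : comp (a *: X + Y) j = a *: comp X j + comp Y j.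
Proof. by apply/funext => x; rewrite /comp !mxE. Qed.

Lemma comp0 j : comp 0 j = 0 :> ('rV[R]_n -> R).
Proof. by apply/funext => x; rewrite /comp mxE. Qed.

Lemma compN X j : comp (- X) j = - comp X j.
Proof. by apply/funext => x; rewrite /comp mxE. Qed.

Lemma compD X Y j : comp (X + Y) j = comp X j + comp Y j.
Proof. by apply/funext => x; rewrite /comp mxE. Qed.

Lemma compZ a X j : comp (a *: X) j = a *: comp X j.
Proof. by apply/funext => x; rewrite /comp mxE. Qed.

Lemma polyfield_linear a X Y : polyfield X -> polyfield Y -> polyfield (a *: X + Y).
Proof.
by move=> pX pY j; rewrite comp_linear; apply: polyfunD => //; apply: polyfunZ.
Qed.

Lemma polyfield_cst v : polyfield (fun=> v).
Proof. by move=> j; apply: polyfun_cst. Qed.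

Lemma comp_bracket_poly X Y j : polyfield X -> polyfield Y ->
  comp (bracket X Y) j = act X (comp Y j) - act Y (comp X j).
Proof. by move=> pX pY; apply: comp_bracket => x; apply: polyfield_diff. Qed.

Lemma polyfield_bracket X Y : polyfield X -> polyfield Y -> polyfield (bracket X Y).
Proof.
by move=> pX pY j; rewrite comp_bracket_poly//; apply: polyfunB; apply: polyfun_act.
Qed.

Lemma bracketC X Y : bracket X Y = - bracket Y X.
Proof. by apply/funext => x; rewrite !bracketE /lie /= opprB. Qed.

(* Both sides are derivations in f, so it is enough to compare them on the
   coordinates; the symmetry of second derivatives is a special case. *)
Lemma act_bracket X Y f : polyfield X -> polyfield Y -> polyfun f ->
  act (bracket X Y) f = act X (act Y f) - act Y (act X f).
Proof.
move=> pX pY; elim=> [c|i|g h pg IHg ph IHh|g h pg IHg ph IHh].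
- by rewrite !act_cst subrr.
- by rewrite !act_coord comp_bracket_poly.
- have [pXg pXh] := (polyfun_act pX pg, polyfun_act pX ph).
  have [pYg pYh] := (polyfun_act pY pg, polyfun_act pY ph).
  rewrite (actD _ pg ph) (actD Y pg ph) (actD X pg ph) (actD X pYg pYh).
  by rewrite (actD Y pXg pXh) IHg IHh opprD addrACA.
- have [pXg pXh] := (polyfun_act pX pg, polyfun_act pX ph).
  have [pYg pYh] := (polyfun_act pY pg, polyfun_act pY ph).
  rewrite (actM _ pg ph) (actM Y pg ph) (actM X pg ph).
  rewrite (actD X (polyfunM pYg ph) (polyfunM pg pYh)) (actM X pYg ph) (actM X pg pYh).
  rewrite (actD Y (polyfunM pXg ph) (polyfunM pg pXh)) (actM Y pXg ph) (actM Y pg pXh).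
  (* Once the iterated derivatives are generalized, a pointwise ring identity remains. *)
  rewrite IHg IHh; move: (act X (act Y g)) (act Y (act X g)) (act X (act Y h)).
  move: (act Y (act X h)) (act X g) (act Y g) (act X h) (act Y h).
  move=> a1 a2 a3 a4 a5 a6 a7 a8; apply/funext => x; rewrite !fctE; ring.
Qed.

(** By [act_bracket], each component becomes a signed sum of second-order terms such as X (Y Z^j),
    and these match. *)
Lemma bracket_jacobi X Y Z : polyfield X -> polyfield Y -> polyfield Z ->
  bracket X (bracket Y Z) = bracket (bracket X Y) Z + bracket Y (bracket X Z).
Proof.
move=> pX pY pZ; apply: field_ext => j.
have pXY := polyfield_bracket pX pY; have pXZ := polyfield_bracket pX pZ.
have pYZ := polyfield_bracket pY pZ.
rewrite compD (comp_bracket_poly j pX pYZ) (comp_bracket_poly j pXY pZ).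
rewrite (comp_bracket_poly j pY pXZ).
rewrite (comp_bracket_poly j pY pZ) (comp_bracket_poly j pX pY) (comp_bracket_poly j pX pZ).
rewrite (act_bracket pY pZ (pX j)) (act_bracket pX pY (pZ j)) (act_bracket pX pZ (pY j)).
rewrite (actB X (polyfun_act pY (pZ j)) (polyfun_act pZ (pY j))).
rewrite (actB Z (polyfun_act pX (pY j)) (polyfun_act pY (pX j))).
rewrite (actB Y (polyfun_act pX (pZ j)) (polyfun_act pZ (pX j))).
by apply/funext => x; rewrite !fctE; ring.
Qed.

Lemma bracket_linearr Z a X Y : polyfield X -> polyfield Y -> polyfield Z ->
  bracket Z (a *: X + Y) = a *: bracket Z X + bracket Z Y.
Proof.
move=> pX pY pZ; apply: field_ext => j; have pXY := polyfield_linear a pX pY.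
rewrite comp_linear
  (comp_bracket_poly _ pZ pXY) (comp_bracket_poly _ pZ pX) (comp_bracket_poly _ pZ pY).
rewrite comp_linear (actD _ (polyfunZ a (pX j)) (pY j)) (actZ _ _ (pX j)).
rewrite (act_linear _ _ _ (pZ j)).
by rewrite opprD addrACA scalerBr.
Qed.

Lemma bracket_linearl Z a X Y : polyfield X -> polyfield Y -> polyfield Z ->
  bracket (a *: X + Y) Z = a *: bracket X Z + bracket Y Z.
Proof.
move=> pX pY pZ; rewrite bracketC (bracket_linearr _ pX pY pZ) (bracketC X) (bracketC Y).
by rewrite opprD scalerN.
Qed.

Lemma polyfield_smooth X : polyfield X -> smooth X.
Proof.
move=> pX k; elim: k X pX => //= k IHk X pX; split=> [x|i]; first exact: polyfield_diff.
apply: IHk => j.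
have -> : comp ('D_(delta_mx 0 i) X) j = act (partial i) (comp X j).
  by apply/funext => x; rewrite actE /comp comp_derive//; exact: polyfield_diff.
apply: polyfun_act => //; exact: polyfield_cst.
Qed.

End PolynomialFunctions.

(** * Fields of a given weight *)

Section Homogeneous.
Context {R : realType} {n : nat}.
Variable r : 'I_n -> nat.
Hypothesis r_gt0 : forall i, (0 < r i)%N.
Implicit Types (f g : 'rV[R]_n -> R) (X Y Z : vfield R n) (w k p : int).

Lemma smooth_differentiable X x : smooth X -> differentiable X x.
Proof. by move=> sX; have [] := sX 1%N. Qed.

Lemma smooth_partial X (i : 'I_n) : smooth X -> smooth ('D_(delta_mx 0 i) X).
Proof. by move=> sX k; have [_] := sX k.+1; apply. Qed.

(** The induction is on a bound N for the weight, since a partial derivative lowers the weight by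
    r_i, possibly by more than 1 and below zero. *)
Lemma smooth_homogeneous_polyfun (N : nat) X j w : w < N%:Z -> smooth X ->
  flow_homogeneous r w%:~R (comp X j) -> polyfun (comp X j).
Proof.
elim: N X w => [|N IHN] X w wN sX hX.
  have -> : comp X j = cst 0; last exact: polyfun_cst.
  apply/funext => x; apply: (flow_homogeneous_lt0 r_gt0 _ _ hX); last by rewrite ltrz0.
  by apply: differentiable_comp_field; exact: smooth_differentiable.
have dX x : differentiable (comp X j) x.
  by apply: differentiable_comp_field; exact: smooth_differentiable.
have [w0|w0|w0] := ltgtP w 0.
- by apply: (IHN X w) => //; apply: lt_le_trans w0 _.
(* Euler's identity divided by the positive weight w. *)
- have -> : comp X j = w%:~R^-1 *: \sum_i ((r i)%:R *: (fun x : 'rV[R]_n => x 0 i)) *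
      comp ('D_(delta_mx 0 i) X) j.
    have w_neq0 : w%:~R != 0 :> R by rewrite intr_eq0 gt_eqF.
    apply: (scalerI w_neq0); rewrite scalerA divff// scale1r.
    apply/funext => x; rewrite fct_sumE.
    have /(_ x) := (flow_homogeneousP r w%:~R dX).2 hX.
    rewrite actE derive_sum_dir// => e; apply: (etrans (esym e)).
    apply: eq_bigr => i _; rewrite mxE -comp_derive//; exact: smooth_differentiable.
  apply/polyfunZ/polyfun_sum => i; apply: polyfunM.
    exact/polyfunZ/polyfun_coord.
  apply: (IHN _ (w - (r i)%:Z)); first by have := r_gt0 i; lia.
    exact: smooth_partial.
  have -> : comp ('D_(delta_mx 0 i) X) j = 'D_(delta_mx 0 i) (comp X j).
    by apply/funext => x; rewrite [LHS]comp_derive//; exact: smooth_differentiable.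
  by rewrite rmorphB/=; exact: flow_homogeneous_partial.
- have -> : comp X j = cst (comp X j 0); last exact: polyfun_cst.
  by rewrite w0 in hX; apply/funext => x; exact: (flow_homogeneous0 r_gt0 _ _ hX).
Qed.

(** Polynomiality is included so that the rules for [act] apply; [grP] provides it for the
    components of a field of given weight. *)
Definition hom w f := polyfun f /\ act (weight_vfield r) f = w%:~R *: f.

Lemma comp_weight j :
  comp (weight_vfield r) j = (r j)%:R *: (fun x : 'rV[R]_n => x 0 j).
Proof. by apply/funext => x; rewrite /comp mxE. Qed.

Lemma polyfield_weight : polyfield (weight_vfield r : vfield R n).
Proof. by move=> j; rewrite comp_weight; exact/polyfunZ/polyfun_coord. Qed.

Lemma hom_flow w f : hom w f -> flow_homogeneous r w%:~R f.
Proof.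
move=> [pf ef]; apply/flow_homogeneousP => x; first exact: polyfun_diff.
by rewrite ef.
Qed.

Lemma hom_lt0 w f : hom w f -> w < 0 -> f = 0.
Proof.
move=> hf w0; apply/funext => x.
apply: (flow_homogeneous_lt0 r_gt0 _ _ (hom_flow hf)); last by rewrite ltrz0.
by case: hf => pf _; exact: polyfun_diff.
Qed.

Lemma hom_le0 w f : hom w f -> w <= 0 -> f = cst (f 0).
Proof.
move=> hf; rewrite le_eqVlt => /orP[/eqP w0|w0]; last by rewrite (hom_lt0 hf w0).
apply/funext => x; apply: (flow_homogeneous0 r_gt0).
  by case: hf => pf _; exact: polyfun_diff.
by have := hom_flow hf; rewrite w0.
Qed.

Lemma hom_cst_eq0 w c : hom w (cst c) -> w != 0 -> c = 0.
Proof.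
move=> [_]; rewrite act_cst => /(congr1 (@^~ 0))/eqP.
by rewrite /= eq_sym => + w0; rewrite mulf_eq0 intr_eq0 (negPf w0) => /eqP.
Qed.

Lemma hom_cst c : hom 0 (cst c).
Proof. by split; [exact: polyfun_cst|rewrite act_cst scale0r]. Qed.

Lemma hom0 w : hom w 0.
Proof. by split; [exact: (polyfun_cst 0)|rewrite act0 scaler0]. Qed.

Lemma homD w f g : hom w f -> hom w g -> hom w (f + g).
Proof.
by move=> [pf ef] [pg eg]; split; [exact: polyfunD|rewrite actD// ef eg scalerDr].
Qed.

Lemma homZ w c f : hom w f -> hom w (c *: f).
Proof.
move=> [pf ef]; split; first exact: polyfunZ.
by rewrite actZ// ef !scalerA mulrC.
Qed.

Lemma hom_sum w (I : finType) (F : I -> 'rV[R]_n -> R) :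
  (forall i, hom w (F i)) -> hom w (\sum_i F i).
Proof. by move=> hF; elim/big_rec: _ => [|i f _]; [exact: hom0|exact: homD]. Qed.

Lemma homM w w' f g : hom w f -> hom w' g -> hom (w + w') (f * g).
Proof.
move=> [pf ef] [pg eg]; split; first exact: polyfunM.
rewrite actM// ef eg; apply/funext => x.
rewrite -[LHS]/(w%:~R * f x * g x + f x * (w'%:~R * g x)).
by rewrite -[RHS]/((w + w')%:~R * (f x * g x)) rmorphD/=; ring.
Qed.

Lemma hom_coord i : hom (r i) (fun x : 'rV[R]_n => x 0 i).
Proof. by split; [exact: polyfun_coord|rewrite act_coord comp_weight]. Qed.

(** As d_j has weight - r_j, its coefficient in a field of weight k has weight k + r_j. The forward
    direction is where smooth fields are found to be polynomial. *)
Lemma grP k X : gr r k X <-> forall j, hom (k + (r j)%:Z) (comp X j).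
Proof.
split=> [[sX eX]|hX].
  have dX x : differentiable X x by exact: smooth_differentiable.
  suff aX j : act (weight_vfield r) (comp X j) = (k + (r j)%:Z)%:~R *: comp X j.
    move=> j; split=> //.
    apply: (@smooth_homogeneous_polyfun (absz (k + (r j)%:Z)).+1 _ _ (k + (r j)%:Z)) => //.
      by lia.
    apply/flow_homogeneousP => x; first exact: differentiable_comp_field.
    by rewrite aX.
  have dW x : differentiable (weight_vfield r : vfield R n) x.
    exact: polyfield_diff polyfield_weight.
  have := comp_bracket j dW dX; rewrite bracketE eX.
  rewrite compZ comp_weight actZ; last exact: polyfun_coord.
  rewrite act_coord => /esym/eqP; rewrite subr_eq => /eqP ->.
  by rewrite rmorphD/= scalerDl.
have pX : polyfield X by move=> j; case: (hX j).
split; first exact: polyfield_smooth.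
rewrite -bracketE; apply: field_ext => j.
rewrite (comp_bracket_poly j polyfield_weight pX) compZ comp_weight.
rewrite (actZ _ _ (polyfun_coord j)) act_coord (hX j).2 rmorphD/= scalerDl.
by rewrite addrK.
Qed.

Lemma gr_polyfield k X : gr r k X -> polyfield X.
Proof. by move=> /grP hX j; case: (hX j). Qed.

Lemma gr0 k : gr r k (0 : vfield R n).
Proof. by apply/grP => j; rewrite comp0; exact: hom0. Qed.

Lemma gr_linear k a X Y : gr r k X -> gr r k Y -> gr r k (a *: X + Y).
Proof.
move=> /grP hX /grP hY; apply/grP => j; rewrite comp_linear.
by apply: homD => //; exact: homZ.
Qed.

(** Apply [act_bracket] to the weight field and X: the commutator of the two operators is k X. *)
Lemma hom_act k w X f : gr r k X -> hom w f -> hom (k + w) (act X f).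
Proof.
move=> gX [pf ef]; have pX := gr_polyfield gX; split; first exact: polyfun_act.
have := act_bracket polyfield_weight pX pf.
rewrite bracketE; case: gX => _ ->; rewrite ef (act_scale _ _ pf) (actZ _ _ pf) => /eqP.
by rewrite eq_sym subr_eq => /eqP ->; rewrite rmorphD/= scalerDl.
Qed.

Lemma gr_bracket k p X Y : gr r k X -> gr r p Y -> gr r (k + p) (bracket X Y).
Proof.
move=> gX gY; have [hX hY] := ((grP _ _).1 gX, (grP _ _).1 gY).
apply/grP => j; rewrite (comp_bracket_poly j (gr_polyfield gX) (gr_polyfield gY)).
rewrite -scaleN1r; have hYX := hom_act gY (hX j); have hXY := hom_act gX (hY j).
by rewrite -addrA; apply: homD => //; rewrite addrCA; exact: homZ.
Qed.

Lemma gr_lt X p : (forall j, p + (r j)%:Z < 0) -> gr r p X -> X = 0.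
Proof.
move=> pr /grP hX; apply: field_ext => j; rewrite comp0; exact: hom_lt0 (hX j) (pr j).
Qed.

Lemma gr_partial i : gr r (- (r i)%:Z) (partial i : vfield R n).
Proof.
apply/grP => j; rewrite [comp _ _](_ : _ = cst ((j == i)%:R)).
  have [->|_] := eqVneq j i; first by rewrite addNr; exact: hom_cst.
  exact: hom0.
by apply/funext => x; rewrite /comp mxE.
Qed.

End Homogeneous.

(** * Brackets of constant, linear and one-component fields *)

Section CoordinateFields.
Context {R : realType} {n : nat}.
Implicit Types (f g : 'rV[R]_n -> R) (X Y Z : vfield R n) (i j k : 'I_n).

Definition fpartial f j : vfield R n := fun x => f x *: delta_mx 0 j.

Lemma comp_fpartial f j k : comp (fpartial f j) k = (k == j)%:R *: f.
Proof. by apply/funext => x; rewrite /comp !mxE eqxx/= mulrC. Qed.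

Lemma polyfield_fpartial f j : polyfun f -> polyfield (fpartial f j).
Proof. by move=> pf k; rewrite comp_fpartial; exact: polyfunZ. Qed.

Lemma sum_fpartial X : X = \sum_j fpartial (comp X j) j.
Proof. by apply/funext => x; rewrite fct_sumE [LHS]row_sum_delta. Qed.

Lemma comp_partial i j : comp (partial i : vfield R n) j = cst (j == i)%:R.
Proof. by apply/funext => x; rewrite /comp mxE. Qed.

Lemma cst_sum_partial (v : 'rV[R]_n) :
  (fun=> v) = \sum_i v 0 i *: partial i :> vfield R n.
Proof. by apply/funext => x; rewrite fct_sumE [LHS]row_sum_delta. Qed.

Lemma act_fpartial f i g : polyfun g -> act (fpartial f i) g = f * act (partial i) g.
Proof.
move=> pg; apply/funext => x; rewrite -[RHS]/(f x * act (partial i) g x) !actE.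
rewrite -[fpartial f i x]addr0 derive_linear_dir; last exact: polyfun_diff.
by rewrite derive0 addr0.
Qed.

Lemma bracket_cst_fpartial v f j : polyfun f ->
  bracket (fun=> v) (fpartial f j) = fpartial (act (fun=> v) f) j.
Proof.
move=> pf; apply: field_ext => k.
rewrite (comp_bracket_poly k (polyfield_cst v) (polyfield_fpartial j pf)).
by rewrite !comp_fpartial (actZ _ _ pf) [comp _ k]/(cst (v 0 k)) act_cst subr0.
Qed.

Lemma bracket_cst (v u : 'rV[R]_n) : bracket (fun=> v) (fun=> u) = 0 :> vfield R n.
Proof.
apply: field_ext => k; rewrite (comp_bracket_poly k (polyfield_cst v) (polyfield_cst u)).
by rewrite comp0 [comp _ k]/(cst (u 0 k)) act_cst [comp _ k]/(cst (v 0 k)) act_cst subrr.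
Qed.

Lemma comp_bracket_partial X i k : polyfield X ->
  comp (bracket (partial i) X) k = act (partial i) (comp X k).
Proof.
move=> pX; rewrite (comp_bracket_poly k (polyfield_cst _) pX).
by rewrite comp_partial act_cst subr0.
Qed.

Lemma bracket_fpartial f g i j : polyfun f -> polyfun g ->
  bracket (fpartial f i) (fpartial g j) =
  fpartial (f * act (partial i) g) j - fpartial (g * act (partial j) f) i.
Proof.
move=> pf pg; apply: field_ext => k.
rewrite (comp_bracket_poly k (polyfield_fpartial i pf) (polyfield_fpartial j pg)).
rewrite compD compN !comp_fpartial (actZ _ _ pf) (actZ _ _ pg).
by rewrite (act_fpartial _ _ pf) (act_fpartial _ _ pg).
Qed.

Lemma act_partial_coord i k : act (partial i) (fun x : 'rV[R]_n => x 0 k) = cst (k == i)%:R.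
Proof. by rewrite act_coord comp_partial. Qed.

Lemma bracket_cst_xpartial v i j :
  bracket (fun=> v) (xpartial i j) = (fun=> v 0 i *: delta_mx 0 j) :> vfield R n.
Proof.
by rewrite -[xpartial i j]/(fpartial (fun x => x 0 i) j) bracket_cst_fpartial ?act_coord//;
  exact: polyfun_coord.
Qed.

Lemma bracket_xpartial i j k l : j != k -> l != i ->
  bracket (xpartial i j) (xpartial k l) = 0 :> vfield R n.
Proof.
move=> jk li; have pc := @polyfun_coord R n.
rewrite -[xpartial i j]/(fpartial (fun x => x 0 i) j) -[xpartial k l]/(fpartial (fun x => x 0 k) l).
rewrite (bracket_fpartial _ _ (pc i) (pc k)) !act_partial_coord eq_sym (negPf jk).
rewrite eq_sym (negPf li); apply/funext => x.
rewrite -[LHS]/((x 0 i * 0) *: delta_mx 0 l - (x 0 k * 0) *: delta_mx 0 j) !mulr0 !scale0r.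
exact: subrr.
Qed.

Lemma bracket_xpartial_trans i j l : l != i ->
  bracket (xpartial i j) (xpartial j l) = xpartial i l :> vfield R n.
Proof.
move=> li; have pc := @polyfun_coord R n.
rewrite -[xpartial i j]/(fpartial (fun x => x 0 i) j) -[xpartial j l]/(fpartial (fun x => x 0 j) l).
rewrite (bracket_fpartial _ _ (pc i) (pc j)) !act_partial_coord eqxx eq_sym (negPf li).
apply/funext => x.
rewrite -[LHS]/((x 0 i * 1) *: delta_mx 0 l - (x 0 j * 0) *: delta_mx 0 j).
by rewrite mulr0 scale0r subr0 mulr1.
Qed.

Lemma gr_fpartial (r : 'I_n -> nat) (p : int) f j :
  hom r (p + (r j)%:Z) f -> gr r p (fpartial f j).
Proof.
move=> hf; have pf : polyfun f by case: hf.
split; first exact/polyfield_smooth/polyfield_fpartial.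
rewrite -bracketE; apply: field_ext => k.
rewrite (comp_bracket_poly k (polyfield_weight r) (polyfield_fpartial j pf)) compZ.
rewrite comp_weight (actZ _ _ (polyfun_coord k)) act_coord comp_fpartial (actZ _ _ pf).
rewrite hf.2; have [->|_] := eqVneq k j; last by rewrite !scale0r !scaler0 subrr.
by rewrite !scale1r -scalerBl rmorphD/= addrK.
Qed.

Lemma gr_xpartial (r : 'I_n -> nat) i j :
  gr r ((r i)%:Z - (r j)%:Z) (xpartial i j : vfield R n).
Proof. by apply: gr_fpartial; rewrite subrK; exact: hom_coord. Qed.

End CoordinateFields.

(** * The Lie algebra of fields of negative weight *)

Section NegativePartTheory.
Context {R : realType} {n : nat}.
Variable r : 'I_n.+1 -> nat.
Hypothesis r_gt0 : forall i, (0 < r i)%N.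
Hypothesis r_max : forall i, (r i <= r ord_max)%N.
Implicit Types (X Y Z : vfield R n.+1) (p : int).

(** Weights below - r_n do not occur in [gneg], but fields of such weight are zero. *)
Lemma gr_gneg p X : p < 0 -> gr r p X -> gneg r X.
Proof.
move=> p0 gX; have [pr|pr] := leqP `|p|%N (r ord_max); last first.
  exists (fun=> 0); split; first by move=> q; exact: gr0.
  rewrite big1// (gr_lt r_gt0 _ gX)// => j; have := r_max j; lia.
(* The summand of index q has weight - (q + 1), hence the predecessor. *)
have qr : (`|p|.-1 < r ord_max)%N by lia.
exists (fun q => if q == Ordinal qr then X else 0); split=> [q|].
  case: eqP => [->|_]; last exact: gr0.
  by rewrite (_ : - _ = p)//=; lia.
by rewrite -big_mkcond big_pred1_eq.
Qed.

Lemma gneg0 : gneg r (0 : vfield R n.+1).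
Proof. by apply: (@gr_gneg (-1)) => //; exact: gr0. Qed.

Lemma gneg_linear a X Y : gneg r X -> gneg r Y -> gneg r (a *: X + Y).
Proof.
move=> [F [gF ->]] [G [gG ->]]; exists (fun q => a *: F q + G q); split=> [q|].
  exact: gr_linear.
by rewrite big_split/= scaler_sumr.
Qed.

Lemma gnegD X Y : gneg r X -> gneg r Y -> gneg r (X + Y).
Proof. by move=> gX gY; rewrite -[X]scale1r; exact: gneg_linear. Qed.

Lemma gnegZ a X : gneg r X -> gneg r (a *: X).
Proof. by move=> gX; rewrite -[_ *: _]addr0; apply: gneg_linear => //; exact: gneg0. Qed.

Lemma gneg_ind (P : vfield R n.+1 -> Prop) :
  (forall p X, p < 0 -> gr r p X -> P X) ->
  (forall X Y, gneg r X -> gneg r Y -> P X -> P Y -> P (X + Y)) ->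
  forall X, gneg r X -> P X.
Proof.
move=> Pgr PD X [F [gF ->]].
(* Membership of the partial sums is carried along because the additive step asks for it. *)
suff [] : gneg r (\sum_p F p) /\ P (\sum_p F p) by [].
have lt0 (q : 'I_(r ord_max)) : - (q.+1)%:Z < 0 by lia.
elim/big_rec: _ => [|q Y _ [gY PY]].
  by split; [exact: gneg0|exact: (Pgr (-1) 0 isT (gr0 _ _))].
have gq := gr_gneg (lt0 q) (gF q).
by split; [exact: gnegD|apply: PD => //; exact: (Pgr _ _ (lt0 q) (gF q))].
Qed.

Lemma gneg_polyfield X : gneg r X -> polyfield X.
Proof.
move: X; apply: gneg_ind => [p X _ /(gr_polyfield r_gt0)//|X Y _ _ pX pY].
by rewrite -[X]scale1r; exact: polyfield_linear.
Qed.

Lemma gneg_partial i : gneg r (partial i : vfield R n.+1).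
Proof.
have gi := @gr_partial R _ r r_gt0 i; apply: (gr_gneg _ gi); have := r_gt0 i; lia.
Qed.

Lemma gneg_xpartial i j : (r i < r j)%N -> gneg r (xpartial i j : vfield R n.+1).
Proof.
by move=> rij; have gij := @gr_xpartial R _ r i j; apply: (gr_gneg _ gij); lia.
Qed.

(** Weight 0 is included so as to cover the adjoint action of g_0. *)
Lemma gneg_bracket_gr p X Y : p <= 0 -> gr r p X -> gneg r Y -> gneg r (bracket X Y).
Proof.
move=> p0 gX; have pX := gr_polyfield r_gt0 gX; move: Y.
apply: gneg_ind => [q Y q0 gY|Y Z gY gZ gXY gXZ].
  by apply: (gr_gneg _ (gr_bracket r_gt0 gX gY)); lia.
rewrite -[Y]scale1r (bracket_linearr 1 (gneg_polyfield gY) (gneg_polyfield gZ) pX).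
exact: gneg_linear.
Qed.

Lemma gneg_bracket X Y : gneg r X -> gneg r Y -> gneg r (bracket X Y).
Proof.
move=> gX gY; move: X gX; apply: gneg_ind => [p X p0 gX|X Z gX gZ gXY gZY].
  by apply: gneg_bracket_gr gX gY; exact: ltW.
rewrite -[X]scale1r.
rewrite (bracket_linearl 1 (gneg_polyfield gX) (gneg_polyfield gZ) (gneg_polyfield gY)).
exact: gneg_linear.
Qed.

(** The Leibniz rule is the Jacobi identity. *)
Lemma derivation0_ad X : gr r 0 X -> derivation0 r (bracket X).
Proof.
move=> gX; have pX := gr_polyfield r_gt0 gX; split.
- by move=> Y; exact: gneg_bracket_gr gX.
- by move=> a Y Z /gneg_polyfield pY /gneg_polyfield pZ; exact: bracket_linearr.
- by move=> p Y p0 gY; rewrite -[p]add0r; exact: gr_bracket.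
- move=> Y Z /gneg_polyfield pY /gneg_polyfield pZ; rewrite -!bracketE.
  exact: bracket_jacobi.
Qed.

(** Serves both to subtract an adjoint action from a derivation and to add one; agreement is asked
    on [gneg] only, where derivations are compared. *)
Lemma derivation0_linear a D1 D2 D : derivation0 r D1 -> derivation0 r D2 ->
  (forall Y, gneg r Y -> D Y = a *: D1 Y + D2 Y) -> derivation0 (R := R) r D.
Proof.
move=> [g1 l1 w1 d1] [g2 l2 w2 d2] eD; split.
- by move=> Y gY; rewrite eD//; apply: gneg_linear; [exact: g1|exact: g2].
- move=> b Y Z gY gZ; rewrite !eD//; last exact: gneg_linear.
  rewrite l1// l2// !scalerDr addrACA; congr (_ + _ + _).
  by rewrite !scalerA mulrC.
- move=> p Y p0 gY; rewrite eD; last exact: (gr_gneg p0 gY).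
  by apply: (gr_linear r_gt0); [exact: w1|exact: w2].
- move=> Y Z gY gZ; have gYZ := gneg_bracket gY gZ; rewrite -!bracketE eD// !eD//.
  have e1 := d1 Y Z gY gZ; have e2 := d2 Y Z gY gZ; rewrite -!bracketE in e1 e2.
  have [pY pZ] := (gneg_polyfield gY, gneg_polyfield gZ).
  have [p1Y p1Z] := (gneg_polyfield (g1 _ gY), gneg_polyfield (g1 _ gZ)).
  have [p2Y p2Z] := (gneg_polyfield (g2 _ gY), gneg_polyfield (g2 _ gZ)).
  rewrite e1 e2 (bracket_linearl a p1Y p2Y pZ) (bracket_linearr a p1Z p2Z pY).
  by rewrite scalerDr addrACA.
Qed.

End NegativePartTheory.

(** * Derivations of weight 0 *)

Section Derivations.
Context {R : realType} {n : nat}.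
Variable r : 'I_n.+1 -> nat.
Hypothesis r_gt0 : forall i, (0 < r i)%N.
Hypothesis r_max : forall i, (r i <= r ord_max)%N.
Variable D : vfield R n.+1 -> vfield R n.+1.
Hypothesis derD : derivation0 r D.
Implicit Types (X Y Z : vfield R n.+1) (p : int) (i j k l : 'I_n.+1).

Lemma bracket0X X : bracket 0 X = 0.
Proof. by apply/funext => x; rewrite bracketE /lie derive0 derive_cst subrr. Qed.

Lemma bracketX0 X : bracket X 0 = 0.
Proof. by rewrite bracketC bracket0X oppr0. Qed.

Lemma derivation_bracket X Y : gneg r X -> gneg r Y ->
  D (bracket X Y) = bracket (D X) Y + bracket X (D Y).
Proof. by case: derD => _ _ _ dD gX gY; rewrite !bracketE dD. Qed.

Lemma derivation_0 : D 0 = 0.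
Proof.
case: derD => _ lD _ _; have g0 := gneg0 r_gt0 r_max.
have := lD 1 0 0 (g0 R) (g0 R); rewrite scale1r addr0 scale1r => /eqP.
by rewrite -subr_eq subrr eq_sym => /eqP.
Qed.

Lemma derivation_sum m (F : 'I_m -> vfield R n.+1) :
  (forall a, gneg r (F a)) -> D (\sum_i F i) = \sum_i D (F i).
Proof.
move=> gF; case: derD => _ lD _ _.
suff [] : gneg r (\sum_i F i) /\ D (\sum_i F i) = \sum_i D (F i) by [].
elim/big_rec2: _ => [|i X Y _ [gY eY]].
  by split; [exact: gneg0|exact: derivation_0].
split; first exact: gnegD.
by rewrite -[F i]scale1r (lD _ _ _ (gF i) gY) eY !scale1r.
Qed.

Lemma derivation_eq0 : (forall p X, p < 0 -> gr r p X -> D X = 0) ->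
  forall X, gneg r X -> D X = 0.
Proof.
case: derD => _ lD _ _ D0; apply: (gneg_ind r_gt0 r_max) => [//|X Y gX gY DX DY].
by rewrite -[X]scale1r lD// DX DY scaler0 addr0.
Qed.

(* The one-forms (D d_i)^k dx^i are closed; as (D d_i)^k has weight
   r_k - r_i, Euler's identity yields the primitive
   (1 / r_k) \sum_i r_i x^i (D d_i)^k. *)
Lemma derivation_partial_ad :
  exists2 X, gr r 0 X & forall i, D (partial i) = bracket X (partial i).
Proof.
case: (derD) => gD _ wD _.
pose Z i := D (partial i).
have gZ i : gr r (- (r i)%:Z) (Z i).
  by apply: wD; [have := r_gt0 i; lia|exact: gr_partial].
have pZ i : polyfield (Z i) by exact: gr_polyfield (gZ i).
(* Apply D to [d_i, d_j] = 0. *)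
have closed i j k : act (partial j) (comp (Z i) k) = act (partial i) (comp (Z j) k).
  have := derivation_bracket (gneg_partial r_gt0 r_max i) (gneg_partial r_gt0 r_max j).
  rewrite [bracket (partial i) _]bracket_cst derivation_0 bracketC.
  move=> /(congr1 (fun X => comp X k)).
  rewrite comp0 compD compN (comp_bracket_partial j k (pZ i)).
  rewrite (comp_bracket_partial i k (pZ j)) => e; apply/esym/subr0_eq.
  by rewrite e addrC.
pose P k : 'rV[R]_n.+1 -> R := \sum_i (comp (weight_vfield r) i * comp (Z i) k).
(* The sign comes from [X, d_i] = - d_i X. *)
pose X : vfield R n.+1 := fun x => \row_k (- (r k)%:R^-1 * P k x).
have XE k : comp X k = - (r k)%:R^-1 *: P k by apply/funext => x; rewrite /comp mxE.
have hZ i k : hom r ((r k)%:Z - (r i)%:Z) (comp (Z i) k).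
  by have /grP-/(_ r_gt0 k) := gZ i; rewrite addrC.
have hP k : hom r (r k) (P k).
  apply: hom_sum => i; rewrite -(subrK (r i)%:Z (r k)) addrC.
  by apply: homM (hZ i k); rewrite comp_weight; apply: homZ; exact: hom_coord.
have gX : gr r 0 X.
  by apply/grP => // k; rewrite XE add0r; exact: homZ.
exists X => // j; apply: field_ext => k.
have pX : polyfield X by exact: gr_polyfield gX.
rewrite bracketC compN comp_bracket_partial// XE actZ; last by case: (hP k).
rewrite scaleNr opprK.
have [pc] : hom r ((r k)%:Z - (r j)%:Z) (comp (Z j) k) by [].
(* [eul] is Euler's identity for (D d_j)^k, of weight r_k - r_j. *)
rewrite act_sum_partial// => eul.
suff -> : act (partial j) (P k) = (r k)%:R *: comp (Z j) k.
  by rewrite scalerA mulVf ?scale1r// pnatr_eq0 -lt0n.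
rewrite act_sum; last by move=> i; apply: polyfunM; [exact: polyfield_weight|exact: pZ].
(* Closedness exchanges i and j in the second term. Summed over i, the first terms contribute r_j
   and the second r_k - r_j times (D d_j)^k, in total r_k. *)
have leibniz i : act (partial j) (comp (weight_vfield r) i * comp (Z i) k) =
    (r j)%:R *: ((i == j)%:R *: comp (Z j) k) +
    comp (weight_vfield r) i * act (partial i) (comp (Z j) k).
  rewrite actM; [|exact: polyfield_weight|exact: pZ].
  rewrite closed; congr (_ + _).
  rewrite comp_weight actZ; last exact: polyfun_coord.
  rewrite act_partial_coord; have [->|_] := eqVneq i j; last first.
    by rewrite scale0r scaler0 /cst scaler0 mul0r.
  by rewrite scale1r; apply/funext => x; rewrite -[LHS]/((r j)%:R * 1 * comp (Z j) k x) mulr1.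
rewrite (eq_bigr _ (fun i _ => leibniz i)) big_split/= eul -scaler_sumr -scaler_suml.
rewrite (bigD1 j)//= eqxx big1 ?addr0; last first.
  by move=> i /negPf ->.
by rewrite scale1r -scalerDl rmorphB/= addrC subrK.
Qed.

End Derivations.

(** * Derivations that kill the coordinate fields *)

Section FlatDerivations.
Context {R : realType} {n : nat}.
Variable r : 'I_n.+1 -> nat.
Hypothesis r_gt0 : forall i, (0 < r i)%N.
Hypothesis r_max : forall i, (r i <= r ord_max)%N.
Variable D : vfield R n.+1 -> vfield R n.+1.
Hypothesis derD : derivation0 r D.
Hypothesis D_partial : forall i, D (partial i) = 0.
Implicit Types (X Y Z : vfield R n.+1) (p : int) (i j k l : 'I_n.+1).

Lemma flat_cst v : D (fun=> v) = 0.
Proof.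
rewrite cst_sum_partial (derivation_sum r_gt0 r_max derD); last first.
  by move=> i; apply: gnegZ => //; exact: gneg_partial.
apply: big1 => i _; case: derD => _ lD _ _; rewrite -[_ *: _]addr0 lD ?D_partial.
- by rewrite scaler0 (derivation_0 r_gt0 r_max derD) addr0.
- exact: gneg_partial.
- exact: gneg0.
Qed.

(** Since D d_i = 0, the field [d_i, D Y] equals D [d_i, Y] = 0, so all partial derivatives of D Y
    vanish. *)
Lemma flat_is_cst p Y : p < 0 -> gr r p Y ->
  (forall i, D (bracket (partial i) Y) = 0) -> D Y = fun=> D Y 0.
Proof.
move=> p0 gY DY0; case: (derD) => _ _ wD _.
have gDY := wD _ _ p0 gY; have gnY := gr_gneg r_gt0 r_max p0 gY.
have pDY := gr_polyfield r_gt0 gDY.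
have dDY i k : act (partial i) (comp (D Y) k) = 0.
  rewrite -comp_bracket_partial//.
  have := derivation_bracket derD (gneg_partial r_gt0 r_max i) gnY.
  by rewrite DY0 D_partial bracket0X add0r => <-; rewrite comp0.
apply: field_ext => k.
(* A component with zero partial derivatives is killed by the weight field, so it has weight 0 and
   is constant. *)
have h0 : hom r 0 (comp (D Y) k).
  split=> //; rewrite scale0r act_sum_partial//; apply: big1 => i _.
  by rewrite dDY mulr0.
by rewrite (hom_le0 r_gt0 h0).
Qed.

(** The vector c_ij: for r_i < r_j the field D (x^i d_j) is constant, so its value at 0 determines
    it. *)
Definition xcoef i j : 'rV[R]_n.+1 := D (xpartial i j) 0.

Lemma flat_xpartial i j : (r i < r j)%N -> D (xpartial i j) = fun=> xcoef i j.
Proof.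
move=> rij; have rij0 : (r i)%:Z - (r j)%:Z < 0 by lia.
apply: (flat_is_cst rij0); first exact: gr_xpartial.
by move=> k; rewrite bracket_cst_xpartial flat_cst.
Qed.

(** A constant multiple of d_k has weight - r_k, while D keeps the weight r_i - r_j. *)
Lemma xcoef_weight i j k : (r i < r j)%N -> xcoef i j 0 k != 0 -> (r i + r k = r j)%N.
Proof.
move=> rij; apply: contraNeq => rijk; case: (derD) => _ _ wD _; apply/eqP.
have rij0 : (r i)%:Z - (r j)%:Z < 0 by lia.
have := wD _ _ rij0 (gr_xpartial r i j).
move=> /(grP r_gt0)/(_ k); rewrite flat_xpartial// => h.
by apply: (hom_cst_eq0 h); lia.
Qed.

Lemma flat_bracket_xpartial i j k l : (r i < r j)%N -> (r k < r l)%N ->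
  D (bracket (xpartial i j) (xpartial k l)) =
  fun=> xcoef i j 0 k *: delta_mx 0 l - xcoef k l 0 i *: delta_mx 0 j.
Proof.
move=> rij rkl.
have gij := @gneg_xpartial R _ _ r_gt0 r_max _ _ rij.
have gkl := @gneg_xpartial R _ _ r_gt0 r_max _ _ rkl.
rewrite (derivation_bracket derD gij gkl) (flat_xpartial rij) (flat_xpartial rkl).
by rewrite bracket_cst_xpartial (bracketC (xpartial i j)) bracket_cst_xpartial.
Qed.

Lemma xcoef_commute i j k l : (r i < r j)%N -> (r k < r l)%N -> j != k -> l != i ->
  xcoef i j 0 k *: delta_mx 0 l = xcoef k l 0 i *: delta_mx 0 j :> 'rV[R]_n.+1.
Proof.
move=> rij rkl jk li; have := flat_bracket_xpartial rij rkl.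
rewrite (bracket_xpartial jk li) (derivation_0 r_gt0 r_max derD).
by move=> /(congr1 (@^~ 0))/esym/subr0_eq.
Qed.

(** The fields x^i d_j and x^k d_j commute; compare the coefficients of d_j. *)
Lemma xcoefC i j k : (r i < r j)%N -> (r k < r j)%N -> xcoef i j 0 k = xcoef k j 0 i.
Proof.
move=> rij rkj.
have [ji jk] : j != i /\ j != k by split; apply/eqP => e; move: rij rkj; rewrite e ltnn.
have /(congr1 (fun v : 'rV[R]_n.+1 => v 0 j)) := xcoef_commute rij rkj jk ji.
by rewrite !mxE !eqxx !mulr1.
Qed.

(** Apply D to [x^i d_j, x^j d_l] = x^i d_l. *)
Lemma xcoef_trans i j l : (r i < r j)%N -> (r j < r l)%N ->
  xcoef i l = xcoef i j 0 j *: delta_mx 0 l - xcoef j l 0 i *: delta_mx 0 j.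
Proof.
move=> rij rjl; have ril := ltn_trans rij rjl; have := flat_bracket_xpartial rij rjl.
rewrite bracket_xpartial_trans; last by apply/eqP => e; move: ril; rewrite e ltnn.
by rewrite flat_xpartial// => /(congr1 (@^~ 0)).
Qed.

Lemma xcoef_ltn i j k : (r i < r j)%N -> xcoef i j 0 k != 0 -> (r k < r j)%N.
Proof. by move=> rij /(xcoef_weight rij); have := r_gt0 i; lia. Qed.

(** If c_ij^k is nonzero then r_k < r_j, so x^i d_j = [x^i d_k, x^k d_j]. The coefficient of d_k
    gives c_ij^k = - c_kj^i, which is - c_ij^k by symmetry. *)
Lemma xcoef_lt_eq0 i j k : (r i < r j)%N -> (r i < r k)%N -> xcoef i j 0 k = 0.
Proof.
move=> rij rik; apply/eqP; apply: contraT => c0; have rkj := xcoef_ltn rij c0.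
have := congr1 (fun v : 'rV[R]_n.+1 => v 0 k) (xcoef_trans rik rkj).
rewrite !mxE !eqxx (_ : (k == j) = false) ?mulr0 ?mulr1 ?add0r; last first.
  by apply/eqP => e; move: rkj; rewrite e ltnn.
by rewrite -(xcoefC rij rkj) => e; move: c0; rewrite (_ : xcoef i j 0 k = 0) ?eqxx//; lra.
Qed.

Lemma xcoef_neq0 i j k : (r i < r j)%N -> xcoef i j 0 k != 0 ->
  [/\ r k = r i, j = ord_max & forall l, l != j -> (r l <= r i)%N].
Proof.
move=> rij c0; have rkj := xcoef_ltn rij c0.
have rki : r k = r i.
  have [rlt|rlt|//] := ltngtP (r k) (r i).
    by move: c0; rewrite (xcoefC rij rkj) (xcoef_lt_eq0 rkj rlt) eqxx.
  by move: c0; rewrite (xcoef_lt_eq0 rij rlt) eqxx.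
(* For r_l > r_i = r_k the fields x^i d_j and x^k d_l commute, and the coefficient of d_l gives
   c_ij^k = 0. *)
have top l : l != j -> (r l <= r i)%N.
  move=> lj; rewrite leqNgt; apply: contra c0 => ril.
  have rkl : (r k < r l)%N by rewrite rki.
  have jk : j != k by apply/eqP => e; move: rkj; rewrite e ltnn.
  have li : l != i by apply/eqP => e; move: ril; rewrite e ltnn.
  have /(congr1 (fun v : 'rV[R]_n.+1 => v 0 l)) := xcoef_commute rij rkl jk li.
  by rewrite !mxE !eqxx (negPf lj) mulr1 mulr0 => ->.
(* If j were not the last index, [top] at the last index would give r_j <= r_n <= r_i. *)
split=> //; apply: contraTeq rij => jmax; rewrite -leqNgt.
by apply: leq_trans (r_max j) (top _ _); rewrite eq_sym.
Qed.

Lemma flat_eq0 : (forall i j, (r i < r j)%N -> D (xpartial i j) = 0) ->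
  forall Y, gneg r Y -> D Y = 0.
Proof.
move=> Dx; apply: (derivation_eq0 r_gt0 r_max derD) => p Y p0 gY.
(* Induction on a bound for p + r_n, the largest weight of a coefficient of Y. *)
have [N] : exists N : nat, p + (r ord_max)%:Z < N%:Z.
  by exists (absz (p + (r ord_max)%:Z)).+1; lia.
elim: N p p0 Y gY => [|N IHN] p p0 Y gY pN.
  rewrite (gr_lt r_gt0 _ gY) ?(derivation_0 r_gt0 r_max derD)// => j.
  by have := r_max j; lia.
have hY j : hom r (p + (r j)%:Z) (comp Y j) by move/(grP r_gt0): gY.
have gFj j : gr r p (fpartial (comp Y j) j) by exact: gr_fpartial.
rewrite [Y]sum_fpartial (derivation_sum r_gt0 r_max derD); last first.
  by move=> j; apply: (gr_gneg r_gt0 r_max p0); exact: gFj.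
apply: big1 => j _; have gF := gFj j; have [prj|prj] := lerP (p + (r j)%:Z) 0.
  by rewrite (hom_le0 r_gt0 (hY j) prj); exact: (flat_cst (comp Y j 0 *: delta_mx 0 j)).
(* Bracketing with d_i lowers the weight to p - r_i, so the induction hypothesis makes D Yj
   constant. *)
set Yj := fpartial _ _ in gF *; have DYj : D Yj = fun=> D Yj 0.
  apply: (flat_is_cst p0) => // i.
  apply: (IHN (p - (r i)%:Z)); [by lia| |by have := r_gt0 i; lia].
  by rewrite addrC; apply: (gr_bracket r_gt0) => //; exact: gr_partial.
suff D0 k : D Yj 0 0 k = 0 by rewrite DYj; apply/funext => x; apply/rowP => k; rewrite D0 mxE.
(* A constant field of weight p has only components k with r_k = - p; then r_k < r_j because p + r_j
   > 0. *)
have [prk|prk] := eqVneq (p + (r k)%:Z) 0; last first.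
  have := (grP r_gt0 _ _).1 (let: And4 _ _ wD _ := derD in wD _ _ p0 gF) k.
  by rewrite DYj => /hom_cst_eq0; exact.
have rkj : (r k < r j)%N by lia.
have YjK : bracket Yj (xpartial k j) = 0.
  have [pY _] := hY j.
  rewrite -[xpartial k j]/(fpartial (fun x => x 0 k) j) bracket_fpartial//.
    2: exact: polyfun_coord.
  rewrite act_partial_coord (_ : (k == j) = false).
    2: by apply/eqP => e; move: rkj; rewrite e ltnn.
  (* The derivative d_j Y^j has weight p < 0, so Y^j does not depend on x^j. *)
  rewrite (_ : act (partial j) (comp Y j) = 0); last first.
    by apply: (hom_lt0 r_gt0 (hom_act r_gt0 (gr_partial r_gt0 j) (hY j))); lia.
  apply/funext => x.
  rewrite -[LHS]/((comp Y j x * 0) *: delta_mx 0 j - (x 0 k * 0) *: delta_mx 0 j).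
  by rewrite !mulr0 scale0r subrr.
(* What remains is [D Yj, x^k d_j] = 0, whose d_j coefficient is the k-th component of D Yj. *)
have := derivation_bracket derD (gr_gneg r_gt0 r_max p0 gF) (gneg_xpartial r_gt0 r_max rkj).
rewrite YjK (derivation_0 r_gt0 r_max derD) (Dx _ _ rkj) bracketX0 addr0 DYj.
rewrite bracket_cst_xpartial => /(congr1 (fun X => X 0 0 j)).
by rewrite !mxE !eqxx mulr1 => <-.
Qed.

End FlatDerivations.

(** * Splitting off the adjoint part, and the two cases of the signature *)

Section Reduction.
Context {R : realType} {m : nat}.
Variable r : 'I_m.+2 -> nat.
Hypothesis r_gt0 : forall i, (0 < r i)%N.
Hypothesis r_mono : forall i j : 'I_m.+2, (i <= j)%N -> (r i <= r j)%N.
Implicit Types (D : vfield R m.+2 -> vfield R m.+2).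

Lemma r_le_max i : (r i <= r ord_max)%N.
Proof. by apply: r_mono; rewrite -ltnS. Qed.

Lemma derivation_flat_part D : derivation0 r D ->
  exists X D', [/\ gr r 0 X, derivation0 r D', forall i, D' (partial i) = 0 &
    forall Y, D Y = lie X Y + D' Y].
Proof.
move=> dD; have [X gX DX] := derivation_partial_ad r_gt0 r_le_max dD.
(* D' is D - ad X, written in the form of [derivation0_linear]. *)
exists X, (fun Y => -1 *: bracket X Y + D Y); split; first exact: gX.
- exact: (derivation0_linear r_gt0 r_le_max (derivation0_ad r_gt0 r_le_max gX) dD).
- by move=> i; rewrite DX scaleN1r addNr.
- by move=> Y; rewrite -bracketE scaleN1r addrA subrr add0r.
Qed.

Lemma xcoef_second_kind D i j k : derivation0 r D -> (forall i, D (partial i) = 0) ->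
  (r i < r j)%N -> xcoef D i j 0 k != 0 ->
  [/\ j = ord_max, r i = r (penult : 'I_m.+2), r k = r (penult : 'I_m.+2)
    & r ord_max = (2 * r (penult : 'I_m.+2))%N].
Proof.
move=> dD D0 rij c0.
have [rki jmax top] := xcoef_neq0 r_gt0 r_le_max dD D0 rij c0.
have rijk := xcoef_weight r_gt0 r_le_max dD D0 rij c0.
subst j.
(* The index n - 1 differs from j = n, so r_(n-1) <= r_i; conversely r_i < r_n forces i <= n - 1.
   Then r_n = r_i + r_k is 2 r_(n-1). *)
have rpi : (r (penult : 'I_m.+2) <= r i)%N.
  by apply: top; rewrite -val_eqE /= neq_ltn ltnSn.
have rip : (r i <= r (penult : 'I_m.+2))%N.
  apply: r_mono; rewrite -ltnS ltn_neqAle -ltnS ltn_ord andbT.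
  by apply/eqP => /= e; move: rij; rewrite (_ : i = ord_max) ?ltnn//; exact: val_inj.
split=> //; lia.
Qed.

End Reduction.

Unset Implicit Arguments.

(* The dimension is n = m + 2; r ord_max and r penult are r_n and r_(n-1). *)
Theorem corollary2p6 (R : realType) (m : nat) (r : 'I_m.+2 -> nat)
    (r_gt0 : forall i, (0 < r i)%N)
    (r_mono : forall i j : 'I_m.+2, (i <= j)%N -> (r i <= r j)%N) :
  ((r ord_max)%:Z - 2 * (r penult)%:Z != 0 ->
     forall D : vfield R m.+2 -> vfield R m.+2, derivation0 r D ->
       exists2 X, gr r 0 X & forall Y, gneg r Y -> D Y = lie X Y) /\
  (r ord_max = (2 * r penult)%N ->
     forall D : vfield R m.+2 -> vfield R m.+2,
       derivation0 r D <->
       exists X D', [/\ gr r 0 X, second_kind r D' &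
         forall Y, gneg r Y -> D Y = lie X Y + D' Y]).
Proof.
have r_max := r_le_max r_mono; split=> [rn D dD|rn D].
  have [X [D' [gX dD' D'0 DE]]] := derivation_flat_part r_gt0 r_mono dD.
  (* It suffices that all c_ij vanish; a nonzero entry would force r_n = 2 r_(n-1). *)
  exists X => // Y gY; rewrite DE (flat_eq0 r_gt0 r_max dD' D'0) ?addr0// => i j rij.
  rewrite (flat_xpartial r_gt0 r_max dD' D'0 rij); apply/funext => x.
  apply/rowP => k; rewrite [RHS]mxE; apply/eqP; apply: contraT => c0.
  have [_ _ _ rn2] := xcoef_second_kind r_gt0 r_mono dD' D'0 rij c0.
  by move: rn; rewrite rn2; lia.
split=> [dD|[X [D' [gX [dD' _ _] DE]]]]; last first.
  have dX := derivation0_ad r_gt0 r_max gX.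
  apply: (derivation0_linear (a := 1) r_gt0 r_max dX dD') => Y gY.
  by rewrite scale1r bracketE; exact: DE.
have [X [D' [gX dD' D'0 DE]]] := derivation_flat_part r_gt0 r_mono dD.
exists X, D'; split; [exact: gX|split; [exact: dD'|exact: D'0|]|by move=> Y _; exact: DE].
(* As r_n = 2 r_(n-1) > r_(n-1), every x^i d_n with i < n has negative weight, so each entry of the
   matrix below is a coefficient of the constant field D' (x^i d_n). *)
have r_emb (i : 'I_m.+1) : (r (emb i) < r ord_max)%N.
  have : (r (emb i) <= r penult)%N by apply: r_mono; rewrite /= -ltnS.
  by have := r_gt0 penult; lia.
exists (\matrix_(i, k) xcoef D' (emb i) ord_max 0 (emb k)); split.
- apply/matrixP => i k; rewrite !mxE.
  exact: (xcoefC r_gt0 r_max dD' D'0 (r_emb k) (r_emb i)).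
- move=> i k; rewrite mxE => c0.
  by have [] := xcoef_second_kind r_gt0 r_mono dD' D'0 (r_emb i) c0.
move=> i j rij; rewrite (flat_xpartial r_gt0 r_max dD' D'0 rij); apply/funext => x.
apply/rowP => k.
have [jmax|jmax] := eqVneq j ord_max; last first.
  rewrite scale0r [RHS]mxE; apply/eqP; apply: contraT => c0.
  have [jn _ _ _] := xcoef_second_kind r_gt0 r_mono dD' D'0 rij c0.
  by rewrite jn eqxx in jmax.
subst j; rewrite scale1r fct_sumE summxE.
(* The sum over k < n has no d_n term, and a nonzero coefficient c_in^n would give r_n = r_(n-1),
   contradicting r_n = 2 r_(n-1) > 0. *)
have [kmax|kmax] := eqVneq k ord_max.
  rewrite big1 => [|l _]; last first.
    by rewrite !mxE/= kmax -val_eqE/= gtn_eqF ?mulr0.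
  apply/eqP; apply: contraT => c0.
  have [_ _ rk _] := xcoef_second_kind r_gt0 r_mono dD' D'0 rij c0.
  by have := r_gt0 penult; move: rk; rewrite kmax; lia.
have km : (k < m.+1)%N by rewrite ltn_neqAle -ltnS ltn_ord andbT.
have -> : k = emb (Ordinal km) by exact: val_inj.
rewrite (bigD1 (Ordinal km))//= big1 => [|l lk]; last first.
  rewrite !mxE (_ : (emb (Ordinal km) == emb l) = false) ?mulr0//.
  by apply/negbTE; apply: contra lk => /eqP/(congr1 val) kl; apply/eqP/val_inj.
by rewrite !mxE !eqxx mulr1 addr0.
Qed.
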